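(* Let $R$ be an associative ring with identity. Then the following hold. (1) $R$ is left generalized morphic if and only if for every finite family $a_1,\dots,a_n\in R$ ($n\ge 1$) there exists $a\in R$ with $\bigcap_{i=1}^{n} l_R(a_i)=Ra$. (2) $R$ is left pseudo-morphic if and only if for every finite family $a_1,\dots,a_n\in R$ ($n\ge 1$) there exists $a\in R$ with $\sum_{i=1}^{n}Ra_i=l_R(a)$.
   Context: For $a\in R$, $l_R(a)=\{r\in R: ra=0\}$ is the left annihilator of $a$. A ring $R$ is left generalized morphic if for every $a\in R$ the left ideal $l_R(a)$ is principal, i.e. $l_R(a)=Rb$ for some $b\in R$. A ring $R$ is left pseudo-morphic if for every $a\in R$ there exists $b\in R$ with $Ra=l_R(b)$. *)

(* Defs.v *)
From mathcomp Require Import all_boot all_order all_algebra.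
From mathcomp Require Import boolp classical_sets.

Set Implicit Arguments.
Unset Strict Implicit.
Unset Printing Implicit Defensive.

Import GRing.Theory.
Local Open Scope ring_scope.
Local Open Scope classical_set_scope.

(* [pzRingType] is the structure of associative unital rings, not assumed
   commutative, and with the zero ring allowed. *)

Definition lann (R : pzRingType) (a : R) : set R := [set r | r * a = 0].

Definition lprincipal (R : pzRingType) (a : R) : set R :=
  [set r * a | r in [set: R]].

Definition sum_sets (R : pzRingType) (n : nat) (I : 'I_n -> set R) : set R :=
  [set \sum_(i < n) x i | x in [set x : 'I_n -> R | forall i, I i (x i)]].

Definition left_generalized_morphic (R : pzRingType) : Prop :=
  forall a : R, exists b : R, lann a = lprincipal b.

Definition left_pseudo_morphic (R : pzRingType) : Prop :=
  forall a : R, exists b : R, lprincipal a = lann b.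

(* Main.v *)
Require Import Defs.
From mathcomp Require Import all_boot all_order all_algebra.
From mathcomp Require Import boolp classical_sets.

(** By induction, both properties reduce to two annihilators or two principal
    left ideals.  If I = Rc and l(cb) = Rd, then I ∩ l(b) = Rdc, because rc
    kills b exactly when r kills cb.  If I = l(c) and Rbc = l(d), then
    Rb + I = l(cd), because xcd = 0 means xc = rbc for some r, i.e.
    x - rb is in l(c) = I. *)

Import GRing.Theory.

Local Open Scope ring_scope.
Local Open Scope classical_set_scope.

Lemma lprincipalP (R : pzRingType) (a x : R) :
  lprincipal a x <-> exists r, x = r * a.
Proof.
by split=> [[r _ <-]|[r ->]]; exists r.
Qed.

Lemma lprincipal_setI_lann (R : pzRingType) (b c d : R) :
  lann (c * b) = lprincipal d ->
  lprincipal c `&` lann b = lprincipal (d * c).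
Proof.
move=> cbd; apply/seteqP; split=> x.
  case=> /lprincipalP[r ->]; rewrite /lann /= -mulrA => rcb0.
  have : lann (c * b) r by [].
  rewrite cbd => /lprincipalP[s ->].
  by apply/lprincipalP; exists s; rewrite mulrA.
move=> /lprincipalP[s ->]; rewrite mulrA; split.
  by apply/lprincipalP; exists (s * d).
have : lann (c * b) (s * d) by rewrite cbd; apply/lprincipalP; exists s.
by rewrite /lann /= mulrA.
Qed.

(** The right-hand side is membership in Rb + l(c), spelled out by elements since [sum_sets] adds
    families of sets indexed by ['I_n]. In the induction, l(c) is the sum of all principal left
    ideals but the first. *)
Lemma lann_mulP (R : pzRingType) (b c d : R) :
  lprincipal (b * c) = lann d ->
  forall x, lann (c * d) x <-> exists r y, lann c y /\ x = r * b + y.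
Proof.
move=> bcd x; split.
  rewrite /lann /= mulrA => xcd0.
  have : lann d (x * c) by [].
  rewrite -bcd => /lprincipalP[r xc].
  exists r, (x - r * b); split; last by rewrite addrC subrK.
  by rewrite mulrBl xc mulrA subrr.
(* Conversely (rb + y)cd = (rbc)d + (yc)d, where rbc lies in Rbc = l(d) and yc = 0. *)
move=> [r [y [yc ->]]].
have : lann d (r * (b * c)) by rewrite -bcd; apply/lprincipalP; exists r.
by rewrite /lann /= [_ * (c * d)]mulrA mulrDl yc addr0 !mulrA.
Qed.

Lemma sum_sets_lprincipalP (R : pzRingType) (n : nat) (a : 'I_n -> R) (x : R) :
  sum_sets (fun i => lprincipal (a i)) x <->
  exists r : 'I_n -> R, x = \sum_(i < n) r i * a i.
Proof.
split=> [[y ya <-]|[r ->]].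
  have /choice[r yr] : forall i, exists r, y i = r * a i.
    by move=> i; apply/lprincipalP; exact: ya.
  by exists r; apply: eq_bigr => i _.
by exists (fun i => r i * a i) => //= i; apply/lprincipalP; exists (r i).
Qed.

(** The head is put last so that, once the tail is known to be Rc, the right-hand side has the shape
    treated in [lprincipal_setI_lann]. *)
Lemma bigcap_ord_recl (T : Type) (n : nat) (A : 'I_n.+1 -> set T) :
  \bigcap_(i : 'I_n.+1) A i =
  (\bigcap_(i : 'I_n) A (lift ord0 i)) `&` A ord0.
Proof.
apply/seteqP; split=> x.
  by move=> xA; split=> [i _|]; exact: xA.
by move=> [xA xA0] i _; case: (unliftP ord0 i) => [j|] ->; [exact: xA|].
Qed.

Lemma left_generalized_morphic_bigcap (R : pzRingType) :
  left_generalized_morphic R -> forall (n : nat) (a : 'I_n -> R),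
  exists b : R, \bigcap_(i : 'I_n) lann (a i) = lprincipal b.
Proof.
move=> Rgm; elim=> [|n IHn] a.
  (* The induction starts at the empty family, whose intersection is all of R = R1. *)
  exists 1; apply/seteqP; split=> x _; last by case.
  by apply/lprincipalP; exists x; rewrite mulr1.
have [c ac] := IHn (fun i => a (lift ord0 i)).
have [d cd] := Rgm (c * a ord0).
by exists (d * c); rewrite bigcap_ord_recl ac; exact: lprincipal_setI_lann.
Qed.

Lemma left_pseudo_morphic_sum (R : pzRingType) :
  left_pseudo_morphic R -> forall (n : nat) (a : 'I_n -> R),
  exists b : R, sum_sets (fun i : 'I_n => lprincipal (a i)) = lann b.
Proof.
move=> Rpm; elim=> [|n IHn] a.
  (* The empty sum is the zero ideal, which is l(1). *)
  exists 1; apply/seteqP; split=> x; rewrite sum_sets_lprincipalP /lann /= mulr1.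
    by case=> r ->; rewrite big_ord0.
  by move=> ->; exists (fun=> 0); rewrite big_ord0.
have [c ac] := IHn (fun i => a (lift ord0 i)).
have [d bcd] := Rpm (a ord0 * c).
exists (c * d); apply/seteqP; split=> x.
  move=> /sum_sets_lprincipalP[r ->]; apply/(lann_mulP _ _ _ _ bcd).
  (* Here y is the sum of the terms of positive index, which lies in l(c) by the choice of c. *)
  rewrite big_ord_recl; exists (r ord0); eexists; split; last by [].
  by rewrite -ac; apply/sum_sets_lprincipalP; exists (fun i => r (lift ord0 i)).
move=> /(lann_mulP _ _ _ _ bcd)[r0 [y [+ ->]]].
rewrite -ac => /sum_sets_lprincipalP[r ->].
apply/sum_sets_lprincipalP.
(* The coefficients are glued: [r0] at index 0, and [r j] at [lift ord0 j]. *)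
exists (fun i => if unlift ord0 i is Some j then r j else r0).
rewrite big_ord_recl unlift_none; congr (_ + _).
by apply: eq_bigr => i _; rewrite liftK.
Qed.

Theorem theorem5 (R : pzRingType) :
  (left_generalized_morphic R <->
     forall (n : nat) (a : 'I_n -> R), (1 <= n)%N ->
       exists b : R, \bigcap_(i : 'I_n) lann (a i) = lprincipal b) /\
  (left_pseudo_morphic R <->
     forall (n : nat) (a : 'I_n -> R), (1 <= n)%N ->
       exists b : R, sum_sets (fun i : 'I_n => lprincipal (a i)) = lann b).
Proof.
split; split.
- by move=> Rgm n a _; exact: left_generalized_morphic_bigcap.
(* The converses, here and for sums below, use the one-element family a. *)
- move=> Rcap a; have [b ab] := Rcap 1 (fun=> a) isT; exists b.
  rewrite -ab; apply/seteqP; split=> x; first by move=> xa i _.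
  by move=> /(_ ord0 I).
- by move=> Rpm n a _; exact: left_pseudo_morphic_sum.
- move=> Rsum a; have [b ab] := Rsum 1 (fun=> a) isT; exists b.
  rewrite -ab; apply/seteqP; split=> x.
    move=> /lprincipalP[r ->]; apply/sum_sets_lprincipalP.
    by exists (fun=> r); rewrite big_ord1.
  move=> /sum_sets_lprincipalP[r ->]; rewrite big_ord1.
  by apply/lprincipalP; exists (r ord0).
Qed.
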